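(* Let $a=e^{2\pi i/3}$ and $$A=\begin{pmatrix}1&1&1\\1&a&\overline a\\1&\overline a&a\end{pmatrix},\qquad B=\begin{pmatrix}1&1&1&0\\1&-1&0&1\\1&0&-1&-1\\0&1&-1&1\end{pmatrix}.$$ Then every unit weighing matrix $UW(n,3)$ is equivalent to a matrix of the form $$A\oplus\cdots\oplus A\oplus B\oplus\cdots\oplus B,$$ i.e. a direct sum of $s$ copies of $A$ followed by $t$ copies of $B$ for some integers $s,t\ge 0$ with $3s+4t=n$.
   Context: $\mathbb{T}$ is the set of complex numbers of absolute value one. A unit weighing matrix $UW(n,p)$ is an $n\times n$ matrix $W$ with entries in $\mathbb{T}\cup\{0\}$ such that $WW^*=pI_n$, where $^*$ is the Hermitian transpose. Two unit weighing matrices are equivalent if one can be obtained from the other by a finite sequence of the operations: permuting rows, permuting columns, multiplying a row by an element of $\mathbb{T}$, multiplying a column by an element of $\mathbb{T}$. The direct sum $\oplus$ denotes the block diagonal matrix with the given diagonal blocks. *)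

(* Defs.v *)
From HB Require Import structures.
From mathcomp Require Export all_boot all_order all_fingroup all_algebra.
From mathcomp Require Export complex.
From mathcomp Require Export reals trigo.
Set Implicit Arguments.
Unset Strict Implicit.
Unset Printing Implicit Defensive.
Import Order.TTheory GRing.Theory Num.Theory.

Local Open Scope ring_scope.
Local Open Scope complex_scope.
Local Open Scope sesquilinear_scope.

Section UnitWeighing.
Variable R : realType.

Definition unit_circle : {pred R[i]} := [pred z | `|z| == 1].

(* [M ^t*] is the Hermitian transpose; [p%:R%:M] is p times the identity. *)
Definition unit_weighing (n p : nat) (W : 'M[R[i]]_n) : Prop :=
  (forall i j, (W i j \in unit_circle) || (W i j == 0))
  /\ W *m W ^t* = p%:R%:M.

Definition scale_row n (k : 'I_n) (c : R[i]) (W : 'M[R[i]]_n) : 'M[R[i]]_n :=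
  \matrix_(i, j) (if i == k then c * W i j else W i j).

Definition scale_col n (k : 'I_n) (c : R[i]) (W : 'M[R[i]]_n) : 'M[R[i]]_n :=
  \matrix_(i, j) (if j == k then c * W i j else W i j).

Inductive equiv_step n (W : 'M[R[i]]_n) : 'M[R[i]]_n -> Prop :=
| StepRowPerm (s : 'S_n) : equiv_step W (row_perm s W)
| StepColPerm (s : 'S_n) : equiv_step W (col_perm s W)
| StepRowScale k c of c \in unit_circle : equiv_step W (scale_row k c W)
| StepColScale k c of c \in unit_circle : equiv_step W (scale_col k c W).

Inductive uw_equiv n (W : 'M[R[i]]_n) : 'M[R[i]]_n -> Prop :=
| EquivRefl : uw_equiv W W
| EquivStep W1 W2 of uw_equiv W W1 & equiv_step W1 W2 : uw_equiv W W2.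

Definition expi (t : R) : R[i] := cos t +i* sin t.

Definition omega : R[i] := expi (2 * pi / 3).

Definition mx_of_rows (m : nat) (rows : seq (seq R[i])) : 'M[R[i]]_m :=
  \matrix_(i < m, j < m) nth 0 (nth [::] rows i) j.

Definition blockA : 'M[R[i]]_3 := mx_of_rows 3
  [:: [:: 1; 1;        1];
      [:: 1; omega;    omega^*];
      [:: 1; omega^*;  omega]].

Definition blockB : 'M[R[i]]_4 := mx_of_rows 4
  [:: [:: 1;  1;  1;  0];
      [:: 1; -1;  0;  1];
      [:: 1;  0; -1; -1];
      [:: 0;  1; -1;  1]].

Lemma direct_sumAB_size s t :
  (\sum_(i < s) 3 + \sum_(i < t) 4 = 3 * s + 4 * t)%N.
Proof. by rewrite !sum_nat_const !card_ord mulnC [(t * 4)%N]mulnC. Qed.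

(* s copies of A followed by t copies of B; the cast only replaces the size
   [\sum_(i < s) 3 + \sum_(i < t) 4] by [3 * s + 4 * t]. *)
Definition direct_sumAB (s t : nat) : 'M[R[i]]_(3 * s + 4 * t) :=
  castmx (direct_sumAB_size s t, direct_sumAB_size s t)
    (block_mx (\mxdiag_(i < s) blockA) 0
              0 (\mxdiag_(i < t) blockB)).

End UnitWeighing.

Arguments direct_sumAB R s t : clear implicits.

(* Main.v *)
(** Two rows of W cannot have supports meeting in exactly one column, since a
    single unimodular number is not zero.  Fix a row with support {a, b, c}.
    Every column has three nonzero entries, so counting how the other rows
    meet {a, b, c} leaves two cases: two further rows have the same support, or
    three further rows meet it in {a, b}, {a, c}, {b, c}, and then the overlap
    rule forces them to share their third column.  Either way a 3x3 or 4x4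
    block splits off as a direct summand; normalizing its first row and column
    makes it A (three unimodular numbers with sum zero are proportional to the
    cube roots of unity) or B, and one inducts on the number of rows. *)

Require Import Defs.
From mathcomp Require Import ring lra zify.
Set Implicit Arguments.
Unset Strict Implicit.
Unset Printing Implicit Defensive.
Import Order.TTheory GRing.Theory Num.Theory.
Local Open Scope ring_scope.
Local Open Scope sesquilinear_scope.

(** * Monomial equivalence and direct sums over finite index types *)

Section MonomialEquivalence.
Variable K : numFieldType.

(** Rows and columns are indexed by arbitrary finite types, and all permutations and scalings act at
    once. Blocks can then be split off and rearranged by bijections of sum types, without casts
    between matrix sizes. *)
Definition mon_equiv (I J I' J' : finType) (f : I -> J -> K)
    (g : I' -> J' -> K) : Prop :=
  exists (r : I' -> I) (c : J' -> J) (u : I' -> K) (v : J' -> K),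
    [/\ bijective r, bijective c, forall i, `|u i| = 1, forall j, `|v j| = 1
      & forall i j, g i j = u i * v j * f (r i) (c j)].

Definition dsum (I J I' J' : finType) (f : I -> J -> K) (g : I' -> J' -> K)
    (x : I + I') (y : J + J') : K :=
  match x, y with
  | inl i, inl j => f i j
  | inr i, inr j => g i j
  | _, _ => 0
  end.

Lemma mon_equiv_reindex (I J I' J' : finType) (f : I -> J -> K)
    (g : I' -> J' -> K) (r : I' -> I) (c : J' -> J) :
  bijective r -> bijective c -> (forall i j, g i j = f (r i) (c j)) ->
  mon_equiv f g.
Proof.
move=> br bc gE; exists r, c, (fun=> 1), (fun=> 1).
by split=> // *; rewrite ?normr1 // !mul1r.
Qed.

Lemma mon_equiv_refl (I J : finType) (f : I -> J -> K) : mon_equiv f f.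
Proof. by apply: (@mon_equiv_reindex _ _ _ _ _ _ id id) => //; exists id. Qed.

Lemma mon_equiv_trans (I1 J1 I2 J2 I3 J3 : finType) (f1 : I1 -> J1 -> K)
    (f2 : I2 -> J2 -> K) (f3 : I3 -> J3 -> K) :
  mon_equiv f1 f2 -> mon_equiv f2 f3 -> mon_equiv f1 f3.
Proof.
move=> [r [c [u [v [br bc u1 v1 f2E]]]]].
move=> [r' [c' [u' [v' [br' bc' u1' v1' f3E]]]]].
exists (r \o r'), (c \o c').
exists (fun i => u' i * u (r' i)), (fun j => v' j * v (c' j)).
split=> [||i|j|i j]; rewrite ?normrM ?u1 ?v1 ?u1' ?v1' ?mulr1 //.
- exact: bij_comp.
- exact: bij_comp.
- by rewrite f3E f2E /=; ring.
Qed.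

Definition sum_map (A A' B B' : Type) (f : A -> B) (g : A' -> B')
    (x : A + A') : B + B' :=
  match x with inl a => inl (f a) | inr a => inr (g a) end.

Lemma sum_map_bij (A A' B B' : Type) (f : A -> B) (g : A' -> B') :
  bijective f -> bijective g -> bijective (sum_map f g).
Proof.
move=> [f' fK f'K] [g' gK g'K]; exists (sum_map f' g').
  by case=> a /=; rewrite ?fK ?gK.
by case=> a /=; rewrite ?f'K ?g'K.
Qed.

Lemma mon_equiv_dsum (I1 J1 I2 J2 I1' J1' I2' J2' : finType)
    (f1 : I1 -> J1 -> K) (f2 : I2 -> J2 -> K)
    (g1 : I1' -> J1' -> K) (g2 : I2' -> J2' -> K) :
  mon_equiv f1 g1 -> mon_equiv f2 g2 ->
  mon_equiv (dsum f1 f2) (dsum g1 g2).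
Proof.
move=> [r [c [u [v [br bc u1 v1 gE]]]]].
move=> [r' [c' [u' [v' [br' bc' u1' v1' gE']]]]].
exists (sum_map r r'), (sum_map c c').
exists (fun x => match x with inl i => u i | inr i => u' i end).
exists (fun x => match x with inl i => v i | inr i => v' i end).
split; try by case.
- exact: sum_map_bij.
- exact: sum_map_bij.
- by case=> [i|i] [j|j] /=; rewrite ?gE ?gE' ?mulr0.
Qed.

Definition sum_assoc (A B C : Type) (x : (A + B) + C) : A + (B + C) :=
  match x with
  | inl (inl a) => inl a | inl (inr b) => inr (inl b) | inr c => inr (inr c)
  end.

Definition sum_swap (A B C : Type) (x : B + (A + C)) : A + (B + C) :=
  match x with
  | inl b => inr (inl b) | inr (inl a) => inl a | inr (inr c) => inr (inr c)
  end.

Lemma sum_assoc_bij (A B C : Type) : bijective (@sum_assoc A B C).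
Proof.
exists (fun x => match x with
  | inl a => inl (inl a) | inr (inl b) => inl (inr b) | inr (inr c) => inr c
  end).
  by case=> [[a|b]|c].
by case=> [a|[b|c]].
Qed.

Lemma sum_swap_bij (A B C : Type) : bijective (@sum_swap A B C).
Proof. by exists (@sum_swap B A C) => -[a|[b|c]]. Qed.

Lemma dsumA (I1 J1 I2 J2 I3 J3 : finType) (f1 : I1 -> J1 -> K)
    (f2 : I2 -> J2 -> K) (f3 : I3 -> J3 -> K) :
  mon_equiv (dsum f1 (dsum f2 f3)) (dsum (dsum f1 f2) f3).
Proof.
apply: (mon_equiv_reindex (sum_assoc_bij _ _ _) (sum_assoc_bij _ _ _)).
by case=> [[i|i]|i] [[j|j]|j].
Qed.

(** Lets a newly found B move past the copies of A, which come first in the final form. *)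
Lemma dsumCA (I1 J1 I2 J2 I3 J3 : finType) (f1 : I1 -> J1 -> K)
    (f2 : I2 -> J2 -> K) (f3 : I3 -> J3 -> K) :
  mon_equiv (dsum f1 (dsum f2 f3)) (dsum f2 (dsum f1 f3)).
Proof.
apply: (mon_equiv_reindex (sum_swap_bij _ _ _) (sum_swap_bij _ _ _)).
by case=> [i|[i|i]] [j|[j|j]].
Qed.

Lemma split_bij m n : bijective (@split m n).
Proof. by exists unsplit; [apply: splitK|apply: unsplitK]. Qed.

Lemma dsum_block_mx m n (A : 'M[K]_m) (B : 'M[K]_n) :
  mon_equiv (dsum A B) (block_mx A 0 0 B).
Proof.
apply: (mon_equiv_reindex (split_bij m n) (split_bij m n)) => i j.
rewrite !mxE; case: (split i) => k; rewrite !mxE;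
  by case: (split j) => l; rewrite ?mxE.
Qed.

Lemma mon_equiv_castmx m n (e : m = n) (A : 'M[K]_m) :
  mon_equiv A (castmx (e, e) A).
Proof. by case: n / e; rewrite castmx_id; apply: mon_equiv_refl. Qed.

Lemma dsum_mxdiag k s (A : 'M[K]_k) :
  mon_equiv (dsum A (\mxdiag_(i < s) A)) (\mxdiag_(i < s.+1) A).
Proof.
rewrite mxdiag_recl; apply: mon_equiv_trans (mon_equiv_castmx _ _).
exact: dsum_block_mx.
Qed.

End MonomialEquivalence.

(** * Arrays of weight three and the splitting off of a summand *)

Section Weighing.
Variable K : numFieldType.

(* For entries that are zero or of modulus one, complex conjugation is
   inversion (with [0^-1 = 0]), so orthogonality is stated with quotients. *)
Record weighing3 (I J : finType) (f : I -> J -> K) : Prop := Weighing3 {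
  w3_unit : forall i j, f i j != 0 -> `|f i j| = 1;
  w3_row : forall i i', \sum_j f i j / f i' j = 3 *+ (i == i');
  w3_col : forall j j', \sum_i f i j / f i j' = 3 *+ (j == j')
}.

Lemma weighing3_tr (I J : finType) (f : I -> J -> K) :
  weighing3 f -> weighing3 (fun j i => f i j).
Proof. by case=> fu fr fc; split=> // j i; apply: fu. Qed.

Lemma weighing3_reindex (I J I' J' : finType) (f : I -> J -> K)
    (r : I' -> I) (c : J' -> J) :
  bijective r -> bijective c -> weighing3 f ->
  weighing3 (fun i j => f (r i) (c j)).
Proof.
move=> br bc [fu fr fc]; split=> [i j|i i'|j j'].
- exact: fu.
- by rewrite -(bij_eq br) -fr (reindex c) //; apply: onW_bij.
- by rewrite -(bij_eq bc) -fc (reindex r) //; apply: onW_bij.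
Qed.

Lemma weighing3_dsum (I J I' J' : finType) (f : I -> J -> K)
    (g : I' -> J' -> K) :
  weighing3 (dsum f g) -> weighing3 f /\ weighing3 g.
Proof.
move=> [fu fr fc]; split; split.
- by move=> i j; apply: (fu (inl i) (inl j)).
- move=> i i'; have := fr (inl i) (inl i'); rewrite big_sumType /= => <-.
  by rewrite [X in _ + X]big1 ?addr0 // => j _; rewrite mul0r.
- move=> j j'; have := fc (inl j) (inl j'); rewrite big_sumType /= => <-.
  by rewrite [X in _ + X]big1 ?addr0 // => i _; rewrite mul0r.
- by move=> i j; apply: (fu (inr i) (inr j)).
- move=> i i'; have := fr (inr i) (inr i'); rewrite big_sumType /= => <-.
  by rewrite [X in X + _]big1 ?add0r // => j _; rewrite mul0r.
- move=> j j'; have := fc (inr j) (inr j'); rewrite big_sumType /= => <-.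
  by rewrite [X in X + _]big1 ?add0r // => i _; rewrite mul0r.
Qed.

(** Since [0 / 0 = 0], the quotient [f i j / f i j] is the indicator of the support, so the diagonal
    row relation counts it. *)
Lemma w3_card (I J : finType) (f : I -> J -> K) (fw : weighing3 f) i :
  #|[pred j | f i j != 0]| = 3%N.
Proof.
apply/eqP; rewrite -(eqr_nat K) -sum1_card natr_sum big_mkcond /=.
have := w3_row fw i i; rewrite eqxx mulr1n => <-; apply/eqP/eq_bigr => j _.
by rewrite inE; case: eqVneq => [->|/divff->]; rewrite ?mul0r.
Qed.

Lemma w3_overlap (I J : finType) (f : I -> J -> K) (fw : weighing3 f) i i' j :
  i != i' -> f i j != 0 -> f i' j != 0 ->
  exists2 j', j' != j & (f i j' != 0) && (f i' j' != 0).
Proof.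
move=> ii' fij fi'j.
case: (pickP [pred j' | (j' != j) && ((f i j' != 0) && (f i' j' != 0))]).
  by move=> j' /= /andP[]; exists j'.
move=> no; have := w3_row fw i i'; rewrite (negPf ii') mulr0n (bigD1 j) //=.
rewrite big1 ?addr0 => [/eqP|j' jj'].
  by rewrite mulf_eq0 invr_eq0 (negPf fij) (negPf fi'j).
have /= := no j'; rewrite jj' /= => /negbT; rewrite negb_and !negbK.
by case/orP=> /eqP->; rewrite ?invr0 ?mulr0 ?mul0r.
Qed.

Definition compl_type k (I : finType) (r : 'I_k -> I) : finType :=
  {i : I | i \notin codom r}.

Definition glue k (I : finType) (r : 'I_k -> I) (x : 'I_k + compl_type r) : I :=
  match x with inl a => r a | inr b => sval b end.

Lemma card_compl_type k (I : finType) (r : 'I_k -> I) :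
  injective r -> (k + #|compl_type r|)%N = #|I|.
Proof.
move=> ri; rewrite card_sig -(cardC (mem (codom r))).
by rewrite card_codom // card_ord.
Qed.

Lemma glue_bij k (I : finType) (r : 'I_k -> I) :
  injective r -> bijective (@glue k I r).
Proof.
move=> ri; apply: inj_card_bij.
  move=> [a|[b nb]] [a'|[b' nb']] //=.
  - by move/ri->.
  - by move=> E; case/negP: nb'; rewrite -E codom_f.
  - by move=> E; case/negP: nb; rewrite E codom_f.
  - by move=> E; congr inr; apply: val_inj.
by rewrite card_sum card_ord card_compl_type.
Qed.

(** The last two hypotheses make both off-diagonal blocks vanish once [glue] lists the chosen rows
    and columns first. The reindexed array is then a direct sum, and its relations restrict to each
    summand. *)
Lemma peel_block k (I J : finType) (f : I -> J -> K) (r : 'I_k -> I)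
    (c : 'I_k -> J) :
  weighing3 f -> injective r -> injective c ->
  (forall a j, f (r a) j != 0 -> j \in codom c) ->
  (forall i b, f i (c b) != 0 -> i \in codom r) ->
  exists2 h : compl_type r -> compl_type c -> K, weighing3 h &
    weighing3 (fun a b => f (r a) (c b)) /\
    mon_equiv f (dsum (fun a b => f (r a) (c b)) h).
Proof.
move=> fw ri ci rc cr; set g := fun a b => f (r a) (c b).
pose h (x : compl_type r) (y : compl_type c) := f (sval x) (sval y).
have dE x y : dsum g h x y = f (glue x) (glue y).
  case: x y => [a|[i ni]] [b|[j nj]] //=.
    by apply/esym/eqP; apply: contraR nj => /rc.
  by apply/esym/eqP; apply: contraR ni => /cr.
have [gw hw] : weighing3 g /\ weighing3 h.
  apply: weighing3_dsum.
  have [fu fr fc] := weighing3_reindex (glue_bij ri) (glue_bij ci) fw.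
  split=> [x y|x x'|y y'].
  - by rewrite dE; apply: fu.
  - by rewrite -fr; apply: eq_bigr => y _; rewrite !dE.
  - by rewrite -fc; apply: eq_bigr => x _; rewrite !dE.
exists h => //; split=> //.
exact: (mon_equiv_reindex (glue_bij ri) (glue_bij ci)).
Qed.

End Weighing.

(** * Combinatorics of the supports *)

Section Supports.

Lemma card3_third (T : finType) (P : pred T) x y :
  #|P| = 3%N -> x != y -> P x -> P y ->
  exists z, [/\ z != x, z != y & P z].
Proof.
move=> P3 xy Px Py.
have /card_gt0P[z] : (0 < #|[predD1 [predD1 P & x] & y]|)%N.
  move: P3; rewrite (cardD1 x) [x \in P]Px (cardD1 y) !inE (eq_sym y) xy.
  by rewrite [y \in P]Py !add1n => -[->].
by rewrite !inE => /and3P[zy zx Pz]; exists z.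
Qed.

Lemma card3_mem (T : finType) (P : pred T) x y z :
  #|P| = 3%N -> x != y -> x != z -> y != z -> P x -> P y -> P z ->
  forall t, P t = (t \in [:: x; y; z]).
Proof.
move=> P3 xy xz yz Px Py Pz t.
have sP : [:: x; y; z] \subset P.
  by apply/subsetP=> w; rewrite !inE => /or3P[] /eqP->.
have u : uniq [:: x; y; z] by rewrite /= !inE negb_or xy xz yz.
have c : #|[:: x; y; z]| = #|P| by rewrite P3 (card_uniqP u).
by have := subset_cardP c sP t; rewrite [t \in P]unfold_in => <-.
Qed.

Variables (I J : finType) (e : I -> J -> bool).

Definition block3_at (i0 i1 i2 : I) (j0 j1 j2 : J) : Prop :=
  [/\ uniq [:: i0; i1; i2], uniq [:: j0; j1; j2],
      {in [:: i0; i1; i2], forall i j, e i j = (j \in [:: j0; j1; j2])}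
    & {in [:: j0; j1; j2], forall j i, e i j = (i \in [:: i0; i1; i2])}].

(** Counting from 0, row k misses column 3 - k, so the zeros lie on the antidiagonal, as in B. The
    column clauses keep all other rows out of these columns. *)
Definition block4_at (i0 i1 i2 i3 : I) (j0 j1 j2 j3 : J) : Prop :=
  [/\ uniq [:: i0; i1; i2; i3], uniq [:: j0; j1; j2; j3],
      [/\ e i0 =1 mem [:: j0; j1; j2], e i1 =1 mem [:: j0; j1; j3],
          e i2 =1 mem [:: j0; j2; j3] & e i3 =1 mem [:: j1; j2; j3]]
    & [/\ e^~ j0 =1 mem [:: i0; i1; i2], e^~ j1 =1 mem [:: i0; i1; i3],
          e^~ j2 =1 mem [:: i0; i2; i3] & e^~ j3 =1 mem [:: i1; i2; i3]]].

Hypothesis row3 : forall i, #|[pred j | e i j]| = 3%N.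
Hypothesis col3 : forall j, #|[pred i | e i j]| = 3%N.
Hypothesis overlap : forall i i' j, i != i' -> e i j -> e i' j ->
  exists2 j', j' != j & e i j' && e i' j'.

Lemma row_mem i x y z : x != y -> x != z -> y != z ->
  e i x -> e i y -> e i z -> forall t, e i t = (t \in [:: x; y; z]).
Proof. exact: (card3_mem (row3 i)). Qed.

Lemma col_mem j x y z : x != y -> x != z -> y != z ->
  e x j -> e y j -> e z j -> forall t, e t j = (t \in [:: x; y; z]).
Proof. exact: (card3_mem (col3 j)). Qed.

(** Columns [a] and [b] are both filled by [i], [p], [q]. Another row through [c] shares a second
    column with [i], which is [a] or [b], so it is [p] or [q]; since [c] lies in two rows besides
    [i], these are both of them. *)
Lemma two_full_cols i p q a b c :
  a != b -> a != c -> b != c -> e i a -> e i b -> e i c ->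
  i != p -> i != q -> p != q ->
  e p a -> e q a -> e p b -> e q b -> e p c /\ e q c.
Proof.
move=> ab ac bc ia ib ic ip iq pq pa qa pb qb.
have Ia := row_mem ab ac bc ia ib ic.
have Ca := col_mem ip iq pq ia pa qa.
have Cb := col_mem ip iq pq ib pb qb.
have pqP x : x != i -> e x c -> (x == p) || (x == q).
  move=> xi xc; have [j jc /andP[xj ij]] := overlap xi xc ic.
  move: ij xj; rewrite Ia !inE (negPf jc) orbF => /orP[] /eqP->.
    by rewrite Ca !inE (negPf xi).
  by rewrite Cb !inE (negPf xi).
have [p' pi' p'c] : exists2 x, x != i & e x c.
  case: (pickP [pred x | (x != i) && e x c]) => [x /andP[]|no].
    by exists x.
  by have := col3 c; rewrite (cardD1 i) !inE ic eq_card0.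
have ip' : i != p' by rewrite eq_sym.
have [q' [q'i q'p q'c]] := card3_third (col3 c) ip' ic p'c.
have p'pq := pqP _ pi' p'c; have q'pq := pqP _ q'i q'c.
move: p'pq q'pq q'p p'c q'c.
by do 2!case/orP=> /eqP->; rewrite ?eqxx.
Qed.

(** If [q] contains [b], the three rows share the support {a, b, c}. Otherwise the overlap rule
    forces the supports abc, abd, acd, bcd for [i], [p], [q], [r], where [r] is the third row
    through [b]. *)
Lemma support_block_aux i p q a b c :
  a != b -> a != c -> b != c -> e i a -> e i b -> e i c ->
  i != p -> i != q -> p != q -> e p a -> e q a -> e p b ->
  (exists i1 i2 j0 j1 j2, block3_at i i1 i2 j0 j1 j2) \/
  (exists i1 i2 i3 j0 j1 j2 j3, block4_at i i1 i2 i3 j0 j1 j2 j3).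
Proof.
move=> ab ac bc ia ib ic ip iq pq pa qa pb.
have [qb|nqb] := boolP (e q b).
  have [pc qc] := two_full_cols ab ac bc ia ib ic ip iq pq pa qa pb qb.
  left; exists p, q, a, b, c; split.
  - by rewrite /= !inE negb_or ip iq pq.
  - by rewrite /= !inE negb_or ab ac bc.
  - by move=> x; rewrite !inE => /or3P[] /eqP-> j; apply: row_mem.
  - by move=> x; rewrite !inE => /or3P[] /eqP-> j; apply: col_mem.
have cb : c != b by rewrite eq_sym.
have Ii := row_mem ab ac bc ia ib ic.
have Ca := col_mem ip iq pq ia pa qa.
have qc : e q c.
  have [j ja /andP[ij qj]] := overlap iq ia qa.
  move: ij qj; rewrite Ii !inE (negPf ja) /= => /orP[] /eqP-> //.
  by rewrite (negPf nqb).
(* If [p] contained [c], the previous lemma with [b] and [c] exchanged would put [b] in [q]. *)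
have npc : ~~ e p c.
  apply/negP=> pc; case/negP: nqb.
  by have [] := two_full_cols ac ab cb ia ic ib ip iq pq pa qa pc qc.
have [r [ri rp rb]] := card3_third (col3 b) ip ib pb.
have rq : r != q by apply: contraNneq nqb => <-.
have nra : ~~ e r a by rewrite Ca !inE !negb_or ri rp rq.
have rc : e r c.
  have [j jb /andP[rj ij]] := overlap ri rb ib.
  move: ij rj; rewrite Ii !inE (negPf jb) /= => /orP[] /eqP-> //.
  by rewrite (negPf nra).
(* The third column of [p] is the fourth column of the block: [q] meets [p] in [a] but not in [b],
   and [r] meets [p] in [b] but not in [a], so each needs [d] as a second common column. *)
have [d [da db pd]] := card3_third (row3 p) ab pa pb.
have ad : a != d by rewrite eq_sym.
have bd : b != d by rewrite eq_sym.
have cd : c != d by apply: contraNneq npc => ->.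
have ir : i != r by rewrite eq_sym.
have pr : p != r by rewrite eq_sym.
have qr : q != r by rewrite eq_sym.
have Ip := row_mem ab ad bd pa pb pd.
have qd : e q d.
  have [j ja /andP[pj qj]] := overlap pq pa qa.
  move: pj qj; rewrite Ip !inE (negPf ja) /= => /orP[] /eqP-> //.
  by rewrite (negPf nqb).
have rd : e r d.
  have [j jb /andP[pj rj]] := overlap pr pb rb.
  move: pj rj; rewrite Ip !inE (negPf jb) /= => /orP[] /eqP-> //.
  by rewrite (negPf nra).
right; exists p, q, r, a, b, c, d; split.
- by rewrite /= !inE !negb_or ip iq pq ir pr qr.
- by rewrite /= !inE !negb_or ab ac bc ad bd cd.
- by split; apply: row_mem.
- by split; apply: col_mem.
Qed.

Lemma support_block i :
  (exists i1 i2 j0 j1 j2, block3_at i i1 i2 j0 j1 j2) \/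
  (exists i1 i2 i3 j0 j1 j2 j3, block4_at i i1 i2 i3 j0 j1 j2 j3).
Proof.
have card3P (T : finType) (P : pred T) x : #|P| = 3%N -> P x ->
    exists y z, [/\ x != y, x != z, y != z, P y & P z].
  move=> P3 Px; case: (pickP [pred y | (x != y) && P y]) => [y /andP[xy Py]|no].
    have [z [zx zy Pz]] := card3_third P3 xy Px Py.
    by exists y, z; rewrite xy (eq_sym x) (eq_sym y) zx zy.
  have := P3; rewrite (cardD1 x) [x \in P]Px eq_card0 // => y.
  by have := no y; rewrite !inE eq_sym.
have [a ia] : exists a, e i a.
  have : (0 < #|[pred j | e i j]|)%N by rewrite row3.
  by case/card_gt0P=> a; exists a.
have [b [c [ab ac bc ib ic]]] := card3P _ _ _ (row3 i) ia.
have [p [q [ip iq pq pa qa]]] := card3P _ _ _ (col3 a) ia.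
(* The second column common to [i] and [p] is [b] or [c]; the two cases differ by exchanging these
   names. *)
have [j ja /andP[ij pj]] := overlap ip ia pa.
have Ii := row_mem ab ac bc ia ib ic.
have cb : c != b by rewrite eq_sym.
move: ij pj; rewrite Ii !inE (negPf ja) /= => /orP[] /eqP-> pj.
  exact: (support_block_aux ab ac bc ia ib ic ip iq pq pa qa pj).
exact: (support_block_aux ac ab cb ia ic ib ip iq pq pa qa pj).
Qed.

End Supports.

(** * Cube roots of unity and the normal forms of the two blocks *)

Section Blocks.
Variable R : realType.
Local Notation C := R[i].

Lemma cos_2pi_div3 : cos (2 * pi / 3) = - 2^-1 :> R.
Proof.
set t : R := 2 * pi / 3; have pi0 := pi_gt0 R.
(* The sign will rule out the root 1. *)
have c0 : cos t < 0.
  have -> : t = - (pi / 3) + pi by rewrite /t; field.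
  rewrite cosDpi cosN oppr_lt0 cos_gt0_pihalf //; apply/andP; split; lra.
(* [2 t] and [t] add up to [2 pi], so [cos t] is a root of [2 X^2 - X - 1]. *)
have : cos (t *+ 2) = cos t.
  have -> : t *+ 2 = - t + pi *+ 2 by rewrite /t; field.
  by rewrite cosD2pi cosN.
rewrite cos_mulr2n => ct.
have : (cos t - 1) * (cos t + 2^-1) = 0.
  by move: ct; rewrite -mulr_natr => ct; nra.
by move/eqP; rewrite mulf_eq0 => /orP[] /eqP; lra.
Qed.

Lemma omega_conjD : omega R + (omega R)^*%C = -1.
Proof.
rewrite /omega /expi cos_2pi_div3; apply/eqP; rewrite eq_complex /=.
by apply/andP; split; apply/eqP; lra.
Qed.

Lemma omega_conjM : omega R * (omega R)^*%C = 1.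
Proof.
by rewrite -sqr_normc /omega /expi normc_def /= cos2Dsin2 sqrtr1 expr1n.
Qed.

Lemma ord3P (P : 'I_3 -> Prop) :
  P (inord 0) -> P (inord 1) -> P (inord 2) -> forall i, P i.
Proof.
by move=> P0 P1 P2 [[|[|[|]]] // p];
  [move: P0|move: P1|move: P2]; congr P; apply: val_inj; rewrite /= inordK.
Qed.

Lemma ord4P (P : 'I_4 -> Prop) :
  P (inord 0) -> P (inord 1) -> P (inord 2) -> P (inord 3) -> forall i, P i.
Proof.
by move=> P0 P1 P2 P3 [[|[|[|[|]]]] // p];
  [move: P0|move: P1|move: P2|move: P3]; congr P; apply: val_inj;
  rewrite /= inordK.
Qed.

Lemma sum_ord3 (F : 'I_3 -> C) :
  \sum_i F i = F (inord 0) + F (inord 1) + F (inord 2).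
Proof.
by rewrite !big_ord_recl big_ord0 addr0 addrA; do !congr (_ + _); congr F;
  apply: val_inj; rewrite /= inordK.
Qed.

Lemma sum_ord4 (F : 'I_4 -> C) :
  \sum_i F i = F (inord 0) + F (inord 1) + F (inord 2) + F (inord 3).
Proof.
by rewrite !big_ord_recl big_ord0 addr0 !addrA; do !congr (_ + _); congr F;
  apply: val_inj; rewrite /= inordK.
Qed.

(** The hypothesis on products says that the normalized entry at (1, 1) is omega. Then row 1, column
    1 and row 2, each orthogonal to the initial one, determine the other three entries. *)
Lemma blockA_normal_form_omega (g : 'I_3 -> 'I_3 -> C) :
  weighing3 g -> (forall i j, g i j != 0) ->
  g (inord 0) (inord 0) * g (inord 1) (inord 1) =
    omega R * (g (inord 1) (inord 0) * g (inord 0) (inord 1)) ->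
  mon_equiv g (blockA R).
Proof.
move=> gw gn0 xw.
have g1 i j : `|g i j| = 1 by apply: w3_unit gw _ _ (gn0 i j).
(* These scalings turn the first row and the first column into ones. *)
exists id, id, (fun i => g (inord 0) (inord 0) / g i (inord 0)).
exists (fun j => (g (inord 0) j)^-1); split; try by exists id.
- by move=> i; rewrite normf_div !g1 divr1.
- by move=> j; rewrite normfV g1 invr1.
have := w3_row gw (inord 1) (inord 0).
have := w3_row gw (inord 2) (inord 0).
have := w3_col gw (inord 1) (inord 0).
rewrite !sum_ord3 -!val_eqE /= !inordK //= !mulr0n.
set a := g (inord 0) (inord 0) in xw *.
set b := g (inord 0) (inord 1) in xw *.
set c := g (inord 0) (inord 2) in xw *.
set d := g (inord 1) (inord 0) in xw *.
set e := g (inord 1) (inord 1) in xw *.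
set f := g (inord 1) (inord 2) in xw *.
set p := g (inord 2) (inord 0) in xw *.
set q := g (inord 2) (inord 1) in xw *.
set r := g (inord 2) (inord 2) in xw *.
have [a0 b0 c0 d0 e0] : [/\ a != 0, b != 0, c != 0, d != 0 & e != 0].
  by split; apply: gn0.
have [f0 p0 q0 r0] : [/\ f != 0, p != 0, q != 0 & r != 0].
  by split; apply: gn0.
move=> E1 E2 E3.
have W : (omega R)^*%C = -1 - omega R.
  by rewrite -omega_conjD addrAC subrr add0r.
have eE : e = omega R * d * b / a by apply: (mulfI a0); rewrite xw; field.
have fE : f = (-1 - omega R) * d * c / a.
  rewrite -[LHS](divfK c0) -[f / c](addKr (d / a + e / b)) E3 eE; field.
  by rewrite a0 b0.
have qE : q = (-1 - omega R) * p * b / a.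
  rewrite -[LHS](divfK p0) -[q / p](addKr (b / a + e / d)) E1 eE; field.
  by rewrite a0 d0.
have rE : r = omega R * p * c / a.
  rewrite -[LHS](divfK c0) -[r / c](addKr (p / a + q / b)) E2 qE; field.
  by rewrite a0 b0.
by elim/ord3P; elim/ord3P; rewrite mxE W !inordK //= -/a -/b -/c -/d -/e -/f
  -/p -/q -/r ?eE ?fE ?qE ?rE; field; rewrite ?a0 ?b0 ?c0 ?d0 ?p0.
Qed.

(** Here [x] and [y] are the entries of row 1 after normalization. Orthogonality to the row of ones,
    together with its conjugate, forces [x] to be omega or its conjugate. *)
Lemma blockA_normal_form (g : 'I_3 -> 'I_3 -> C) :
  weighing3 g -> (forall i j, g i j != 0) -> mon_equiv g (blockA R).
Proof.
move=> gw gn0.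
set x := g (inord 0) (inord 0) * g (inord 1) (inord 1)
  / (g (inord 1) (inord 0) * g (inord 0) (inord 1)).
set y := g (inord 0) (inord 0) * g (inord 1) (inord 2)
  / (g (inord 1) (inord 0) * g (inord 0) (inord 2)).
have x0 : x != 0 by rewrite !mulf_neq0 ?invr_eq0 ?mulf_neq0 ?gn0.
have y0 : y != 0 by rewrite !mulf_neq0 ?invr_eq0 ?mulf_neq0 ?gn0.
have yE : y = -1 - x.
  have := w3_row gw (inord 1) (inord 0).
  rewrite sum_ord3 -val_eqE /= !inordK //= mulr0n => E.
  apply: (mulfI (mulf_neq0 (gn0 (inord 1) (inord 0))
    (invr_neq0 (gn0 (inord 0) (inord 0))))).
  rewrite -[LHS]subr0 -E /x /y; field.
  by rewrite !gn0.
(* Exchanging the two rows in the orthogonality relation inverts all ratios, which amounts to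
   conjugating it. *)
have xV : x^-1 + y^-1 = -1.
  have := w3_row gw (inord 0) (inord 1).
  rewrite sum_ord3 -val_eqE /= !inordK //= mulr0n => E.
  apply: (mulfI (mulf_neq0 (gn0 (inord 0) (inord 0))
    (invr_neq0 (gn0 (inord 1) (inord 0))))).
  rewrite -[LHS]subr0 -E /x /y; field.
  by rewrite !gn0.
(* [x] and [y] have sum -1 and product 1, exactly as omega and its conjugate. *)
have xy : x * y = 1.
  have E : (x^-1 + y^-1) * (x * y) = x + y by field; rewrite x0 y0.
  transitivity (- (-1 * (x * y))); first by ring.
  by rewrite -xV E yE; ring.
have : (x - omega R) * (x - (omega R)^*%C) = 0.
  transitivity (x ^+ 2 - (omega R + (omega R)^*%C) * x
    + omega R * (omega R)^*%C); first by ring.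
  rewrite omega_conjD omega_conjM; transitivity (1 - x * y).
    by rewrite yE; ring.
  by rewrite xy subrr.
move/eqP; rewrite mulf_eq0 !subr_eq0 => /orP[] /eqP xw.
  apply: blockA_normal_form_omega => //; rewrite -xw /x divfK //.
  by rewrite mulf_neq0.
(* When [x] is the conjugate of omega, [y] is omega, so swapping the last two columns reduces to the
   first case. *)
pose c : 'I_3 -> 'I_3 := tperm (inord 1) (inord 2).
have bc : bijective c by exists c; apply: tpermK.
have bid : bijective (@id 'I_3) by exists id.
apply: (@mon_equiv_trans _ _ _ _ _ _ _ _ (fun i j => g i (c j))).
  exact: (mon_equiv_reindex bid bc).
apply: blockA_normal_form_omega; first exact: (weighing3_reindex bid bc gw).
  by move=> i j; apply: gn0.
have -> : omega R = y by rewrite yE xw -omega_conjD addrK.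
rewrite /c tpermL tpermD -?val_eqE /= ?inordK // /y divfK //.
by rewrite mulf_neq0.
Qed.

Lemma blockB_normal_form (g : 'I_4 -> 'I_4 -> C) :
  weighing3 g -> (forall i j, (g i j != 0) = (j != rev_ord i)) ->
  mon_equiv g (blockB R).
Proof.
move=> gw gn0.
have nz i j : (i < 4)%N -> (j < 4)%N -> (i + j != 3)%N ->
    g (inord i) (inord j) != 0.
  by move=> i4 j4 ij; rewrite gn0 -val_eqE /= !inordK //; lia.
have g1 i j : (i < 4)%N -> (j < 4)%N -> (i + j != 3)%N ->
    `|g (inord i) (inord j)| = 1.
  by move=> i4 j4 ij; apply: (w3_unit gw); apply: nz.
have z i j : (i < 4)%N -> (j < 4)%N -> (i + j = 3)%N ->
    g (inord i) (inord j) = 0.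
  move=> i4 j4 ij; apply/eqP; have := gn0 (inord i) (inord j).
  by rewrite -val_eqE /= !inordK //; lia.
pose a := g (inord 0) (inord 0).
pose b := g (inord 0) (inord 1).
pose c := g (inord 1) (inord 0).
pose d := g (inord 2) (inord 0).
pose p := g (inord 3) (inord 1).
pose q := g (inord 1) (inord 3).
(* Chosen so that the nonzero entries of the first row and column, and those at (1, 3) and (3, 1),
   become 1. *)
pose u : seq C := [:: 1; a / c; a / d; b / p].
pose v : seq C := [:: a^-1; b^-1; (g (inord 0) (inord 2))^-1; c / (a * q)].
exists id, id, (fun i : 'I_4 => nth 0 u i), (fun j : 'I_4 => nth 0 v j).
split; try by exists id.
- by elim/ord4P; rewrite !inordK //= ?normr1 // normf_div ?g1 ?divr1.
- by elim/ord4P; rewrite !inordK //= /a /b /c /q ?normf_div ?normfV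
    ?normrM ?g1 ?invr1 ?mulr1 ?divr1.
have := w3_row gw (inord 1) (inord 0).
have := w3_row gw (inord 2) (inord 0).
have := w3_row gw (inord 3) (inord 0).
have := w3_row gw (inord 2) (inord 1).
have := w3_row gw (inord 3) (inord 1).
rewrite !sum_ord4 -!val_eqE /= !inordK //= !mulr0n.
rewrite (z 0 3 isT isT erefl)%N (z 1 2 isT isT erefl)%N.
rewrite (z 2 1 isT isT erefl)%N (z 3 0 isT isT erefl)%N.
rewrite !(invr0, mul0r, mulr0, addr0, add0r).
(* Any two rows share exactly two columns, so each orthogonality relation has two terms and
   determines one entry. Five relations give the five entries not yet normalized. *)
have solve (x y w : C) : w != 0 -> x + y / w = 0 -> y = - (x * w).
  move=> w0 /eqP; rewrite addrC addr_eq0 => /eqP yw.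
  by rewrite -mulNr -yw divfK.
move=> /solve E31 /solve E21 /solve E30 /solve E20 /solve E10.
have {}E10 := E10 (nz 0 1 isT isT isT)%N.
have {}E20 := E20 (nz 0 2 isT isT isT)%N.
have {}E30 := E30 (nz 0 2 isT isT isT)%N.
have {}E21 := E21 (nz 1 3 isT isT isT)%N.
have {}E31 := E31 (nz 1 3 isT isT isT)%N.
elim/ord4P; elim/ord4P; rewrite mxE !inordK //= /a /b /c /d /p /q.
all: rewrite ?(z 0 3 isT isT erefl)%N ?(z 1 2 isT isT erefl)%N.
all: rewrite ?(z 2 1 isT isT erefl)%N ?(z 3 0 isT isT erefl)%N ?mulr0 //.
all: by rewrite ?E31 ?E30 ?E21 ?E20 ?E10; field; rewrite ?nz.
Qed.

(** * Decomposition into blocks by induction *)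

Lemma codom_tnth (T : finType) k (t : k.-tuple T) x :
  (x \in codom (tnth t)) = (x \in t).
Proof.
by apply/codomP/tnthP => -[i ->]; exists i.
Qed.

Lemma eq_card_bij (S T : finType) :
  #|S| = #|T| -> exists f : S -> T, bijective f.
Proof.
move=> e; exists (fun x => enum_val (cast_ord e (enum_rank x))).
exists (fun y => enum_val (cast_ord (esym e) (enum_rank y))) => x.
  by rewrite enum_valK cast_ordK enum_rankK.
by rewrite enum_valK cast_ordKV enum_rankK.
Qed.

Lemma weighing3_direct_sum (I J : finType) (f : I -> J -> C) :
  weighing3 f -> exists s t,
    mon_equiv f (dsum (\mxdiag_(i < s) blockA R) (\mxdiag_(i < t) blockB R)).
Proof.
have [n] := ubnP #|I|; elim: n I J f => // n IHn I J f In fw.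
case: (pickP (predT : pred I)) => [i0 _|noI]; last first.
  have I0 : #|I| = 0%N by apply: eq_card0.
  (* Without rows, the diagonal relation of a column would read 0 = 3. *)
  have J0 : #|J| = 0%N.
    apply: eq_card0 => j; have := w3_col fw j j.
    rewrite big_pred0 // eqxx mulr1n => /esym/eqP.
    by rewrite pnatr_eq0.
  have E0 : #|{: 'I_(\sum_(i < 0) 3) + 'I_(\sum_(i < 0) 4)}| = 0%N.
    by rewrite card_sum !card_ord !big_ord0.
  have [r br] := eq_card_bij (etrans E0 (esym I0)).
  have [c bc] := eq_card_bij (etrans E0 (esym J0)).
  exists 0%N, 0%N; apply: (mon_equiv_reindex br bc) => i.
  by have := card0_eq E0 i.
have row3 := w3_card fw; have col3 := w3_card (weighing3_tr fw).
(* Splits off a block and applies the induction hypothesis to the rest; the successor in the tuple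
   length makes the rest strictly smaller. *)
have peel k (r : k.+1.-tuple I) (c : k.+1.-tuple J) : uniq r -> uniq c ->
    (forall a j, f (tnth r a) j != 0 -> j \in c) ->
    (forall i b, f i (tnth c b) != 0 -> i \in r) ->
    weighing3 (fun a b => f (tnth r a) (tnth c b)) /\
    exists s t, mon_equiv f (dsum (fun a b => f (tnth r a) (tnth c b))
      (dsum (\mxdiag_(i < s) blockA R) (\mxdiag_(i < t) blockB R))).
  move=> /tuple_uniqP ri /tuple_uniqP ci rc cr.
  have [||h hw [gw fh]] := peel_block fw ri ci.
  - by move=> a j /rc; rewrite codom_tnth.
  - by move=> i b /cr; rewrite codom_tnth.
  split=> //; have [|s [t hst]] := IHn _ _ _ _ hw.
    by move: In; rewrite -(card_compl_type ri) /=; lia.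
  exists s, t; apply: mon_equiv_trans fh _.
  exact: mon_equiv_dsum (mon_equiv_refl _) hst.
have [] := support_block row3 col3 (w3_overlap fw) i0.
- move=> [i1 [i2 [j0 [j1 [j2 [ui uj rP cP]]]]]].
  have [||gw [s [t fst]]] := peel _ [tuple i0; i1; i2] [tuple j0; j1; j2] ui uj.
  + by move=> a j; rewrite rP //; apply: mem_tnth.
  + by move=> i b; rewrite cP //; apply: mem_tnth.
  exists s.+1, t; apply: (mon_equiv_trans fst).
  apply: mon_equiv_trans (mon_equiv_dsum (dsum_mxdiag _ _) (mon_equiv_refl _)).
  apply: mon_equiv_trans (dsumA _ _ _).
  apply: mon_equiv_dsum (mon_equiv_refl _); apply: blockA_normal_form => // a b.
  by rewrite rP; apply: mem_tnth.
- move=> [i1 [i2 [i3 [j0 [j1 [j2 [j3 [ui uj [r0 r1 r2 r3] [c0 c1 c2 c3]]]]]]]]].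
  have [||gw [s [t fst]]] :=
      peel _ [tuple i0; i1; i2; i3] [tuple j0; j1; j2; j3] ui uj.
  + elim/ord4P=> j; rewrite (tnth_nth i0) /= inordK // => fj;
      [move: (r0 j)|move: (r1 j)|move: (r2 j)|move: (r3 j)];
      by rewrite fj !inE => /esym/or3P[] /eqP->; rewrite eqxx ?orbT.
  + move=> i; elim/ord4P; rewrite (tnth_nth j0) /= inordK // => fi;
      [move: (c0 i)|move: (c1 i)|move: (c2 i)|move: (c3 i)];
      by rewrite /= fi !inE => /esym/or3P[] /eqP->; rewrite eqxx ?orbT.
  (* The new B is carried past the copies of A and then joined to the copies of B. *)
  exists s, t.+1; apply: (mon_equiv_trans fst).
  apply: mon_equiv_trans (mon_equiv_dsum (mon_equiv_refl _) (dsum_mxdiag _ _)).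
  apply: mon_equiv_trans (dsumCA _ _ _).
  apply: mon_equiv_dsum (mon_equiv_refl _); apply: blockB_normal_form => // a b.
  have symj := (eq_sym j1 j0, eq_sym j2 j0, eq_sym j3 j0, eq_sym j2 j1,
    eq_sym j3 j1, eq_sym j3 j2).
  move: uj; rewrite /= !inE !negb_or andbT.
  move=> /and3P[/and3P[ab ac ad] /andP[bc bd] cd].
  have neqj := (negPf ab, negPf ac, negPf ad, negPf bc, negPf bd, negPf cd).
  by move: a b; elim/ord4P; elim/ord4P;
    rewrite -val_eqE !(tnth_nth i0, tnth_nth j0) /= !inordK //= ?[f i0 _ != 0]r0
    ?[f i1 _ != 0]r1 ?[f i2 _ != 0]r2 ?[f i3 _ != 0]r3
    /= !inE ?symj ?eqxx ?neqj ?orbT.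
Qed.

(** * From monomial equivalence back to sequences of elementary operations *)

Lemma uw_equiv_trans n (W1 W2 W3 : 'M[C]_n) :
  uw_equiv W1 W2 -> uw_equiv W2 W3 -> uw_equiv W1 W3.
Proof. by move=> e12; elim=> // W W' _ e1W; apply: EquivStep. Qed.

(** Rows are scaled one at a time, by induction on a list of rows; its being duplicate-free ensures
    that no row is scaled twice. *)
Lemma uw_equiv_scale_rows n (W : 'M[C]_n) (u : 'I_n -> C) :
  (forall i, `|u i| = 1) -> uw_equiv W (\matrix_(i, j) (u i * W i j)).
Proof.
move=> u1.
suff H (s : seq 'I_n) : uniq s ->
    uw_equiv W (\matrix_(i, j) ((if i \in s then u i else 1) * W i j)).
  have -> : \matrix_(i, j) (u i * W i j)
      = \matrix_(i, j) ((if i \in enum 'I_n then u i else 1) * W i j).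
    by apply/matrixP => i j; rewrite !mxE mem_enum.
  exact/H/enum_uniq.
elim: s => [_|k s IHs /andP[ks us]].
  rewrite [X in uw_equiv _ X](_ : _ = W); first exact: EquivRefl.
  by apply/matrixP => i j; rewrite mxE mul1r.
apply: EquivStep (IHs us) _.
rewrite [X in equiv_step _ X](_ : _ = scale_row k (u k)
    (\matrix_(i, j) ((if i \in s then u i else 1) * W i j))).
  by apply: StepRowScale; rewrite inE u1.
apply/matrixP => i j; rewrite !mxE inE; case: eqVneq => //= ->.
by rewrite (negPf ks) mul1r.
Qed.

Lemma uw_equiv_scale_cols n (W : 'M[C]_n) (v : 'I_n -> C) :
  (forall j, `|v j| = 1) -> uw_equiv W (\matrix_(i, j) (v j * W i j)).
Proof.
move=> v1.
suff H (s : seq 'I_n) : uniq s ->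
    uw_equiv W (\matrix_(i, j) ((if j \in s then v j else 1) * W i j)).
  have -> : \matrix_(i, j) (v j * W i j)
      = \matrix_(i, j) ((if j \in enum 'I_n then v j else 1) * W i j).
    by apply/matrixP => i j; rewrite !mxE mem_enum.
  exact/H/enum_uniq.
elim: s => [_|k s IHs /andP[ks us]].
  rewrite [X in uw_equiv _ X](_ : _ = W); first exact: EquivRefl.
  by apply/matrixP => i j; rewrite mxE mul1r.
apply: EquivStep (IHs us) _.
rewrite [X in equiv_step _ X](_ : _ = scale_col k (v k)
    (\matrix_(i, j) ((if j \in s then v j else 1) * W i j))).
  by apply: StepColScale; rewrite inE v1.
apply/matrixP => i j; rewrite !mxE inE; case: eqVneq => //= ->.
by rewrite (negPf ks) mul1r.
Qed.

(** The simultaneous operation is carried out as a row permutation, a column permutation, then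
    column scalings and row scalings. *)
Lemma mon_equiv_uw_equiv n (W W' : 'M[C]_n) : mon_equiv W W' -> uw_equiv W W'.
Proof.
move=> [r [c [u [v [/bij_inj ri /bij_inj ci u1 v1 W'E]]]]].
pose P := col_perm (perm ci) (row_perm (perm ri) W).
have WP : uw_equiv W P.
  apply: EquivStep (StepColPerm _ _); apply: EquivStep (StepRowPerm _ _).
  exact: EquivRefl.
apply: uw_equiv_trans WP _.
apply: uw_equiv_trans (uw_equiv_scale_cols P v1) _.
have -> : W' = \matrix_(i, j) (u i * (\matrix_(i, j) (v j * P i j)) i j).
  by apply/matrixP => i j; rewrite W'E !mxE !permE mulrA.
exact: uw_equiv_scale_rows.
Qed.

Lemma conj_inv (z : C) : (z \in @unit_circle R) || (z == 0) -> z^* = z^-1.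
Proof.
case/orP=> [|/eqP->]; last by rewrite rmorph0 invr0.
by rewrite inE invC_norm => /eqP->; rewrite expr1n invr1 mul1r.
Qed.

(** Conjugates are inverses here, so the row relations restate the hypothesis. For the columns, a
    third of the Hermitian transpose is a right inverse of the square matrix [W], hence also a left
    inverse. *)
Lemma unit_weighing_weighing3 n (W : 'M[C]_n) :
  unit_weighing 3 W -> weighing3 W.
Proof.
move=> [Wu WW].
have WW' : W ^t* *m W = 3%:R%:M.
  have /mulmx1C : W *m (3%:R^-1 *: W ^t*) = 1%:M.
    by rewrite -scalemxAr WW scale_scalar_mx mulVf // pnatr_eq0.
  move/(congr1 (fun M => 3%:R *: M)).
  rewrite -scalemxAl scalerA divff ?pnatr_eq0 // scale1r => ->.
  by rewrite scale_scalar_mx mulr1.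
split=> [i j|i i'|j j'].
- by have := Wu i j; rewrite inE => /orP[/eqP|/eqP->] //; rewrite eqxx.
- move/matrixP: WW => /(_ i i'); rewrite !mxE => <-; apply: eq_bigr => j _.
  by rewrite !mxE conj_inv.
- rewrite eq_sym; move/matrixP: WW' => /(_ j' j); rewrite !mxE => <-.
  apply: eq_bigr => i _.
  by rewrite !mxE conj_inv // mulrC.
Qed.

End Blocks.

Theorem theorem12 (R : realType) (n : nat) (W : 'M[R[i]]_n)
    (hW : unit_weighing 3 W) :
  exists (s t : nat) (e : (3 * s + 4 * t)%N = n),
    uw_equiv W (castmx (e, e) (direct_sumAB R s t)).
Proof.
have [s [t Wst]] := weighing3_direct_sum (unit_weighing_weighing3 hW).
have WD : mon_equiv W (direct_sumAB R s t).
  apply: mon_equiv_trans Wst _.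
  exact: mon_equiv_trans (dsum_block_mx _ _) (mon_equiv_castmx _ _).
(* The sizes agree because the equivalence contains a bijection of the row indices. *)
have e : (3 * s + 4 * t)%N = n.
  have [r [_ [_ [_ [br _ _ _ _]]]]] := WD.
  by have := bij_eq_card br; rewrite !card_ord.
exists s, t, e; apply: mon_equiv_uw_equiv.
exact: mon_equiv_trans WD (mon_equiv_castmx _ _).
Qed.
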